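(* Let $\mathcal{H}$ be a real Hilbert space, let $m\geq2$, $I=\{1,2,\ldots,m\}$, and let $C_1,C_2,\ldots,C_m\subseteq\mathcal{H}$ be nonempty closed convex sets with a nonempty intersection. Let $w_r>0$ for $r=2,3,\ldots,m$ with $\sum_{r=2}^mw_r=1$. If $\operatorname{int}\bigcap_{i\in I}C_i\neq\emptyset$, then for any $x^0\in\mathcal{H}$, the sequence $\{x^k\}_{k=0}^\infty$ generated by $$x^{k+1}=\sum_{r=2}^{m}w_r\,T_{C_1,C_2,\ldots,C_r}(x^k),\qquad k=0,1,2,\ldots,$$ where $T_{C_1,C_2,\ldots,C_r}$ is the generalized $r$-set-Douglas-Rachford operator, converges strongly to a point $x^*\in\bigcap_{i\in I}C_i$.
   Context: For a nonempty closed convex set $C\subseteq\mathcal{H}$, $P_C$ is the orthogonal (nearest point, metric) projection onto $C$ and $R_C:=2P_C-\mathrm{Id}$ is the reflection operator into $C$, where $\mathrm{Id}$ is the identity. For $r=2,3,\ldots,m$, the composite reflection operator is $V_{C_1,C_2,\ldots,C_r}:=R_{C_r}R_{C_{r-1}}\cdots R_{C_1}:\mathcal{H}\to\mathcal{H}$ (composition, $R_{C_1}$ applied first), and the generalized $r$-set-Douglas-Rachford operator is $T_{C_1,C_2,\ldots,C_r}:=\frac12\left(\mathrm{Id}+V_{C_1,C_2,\ldots,C_r}\right)$. *)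

(* Defs.v *)
From HB Require Import structures.
From mathcomp Require Import all_boot all_order all_algebra.
From mathcomp Require Import sesquilinear.
From mathcomp Require Import all_classical all_reals all_analysis.

Set Implicit Arguments.
Unset Strict Implicit.
Unset Printing Implicit Defensive.

Import Order.TTheory GRing.Theory Num.Theory.
Import numFieldNormedType.Exports.

Local Open Scope classical_set_scope.
Local Open Scope ring_scope.

Section DouglasRachford.
Context (R : realType) (H : normedModType R).
Implicit Types (C : set H) (x : H).

Definition nearest_points C x : set H :=
  [set p | C p /\ forall y, C y -> `|x - p| <= `|x - y|].

(* In a Hilbert space [nearest_points C x] is a singleton as soon as [C] is
   nonempty, closed and convex; the default value [x] is taken only when there
   is no nearest point. *)
Definition projection C x : H := xget x (nearest_points C x).

Definition reflection C x : H := 2 *: projection C x - x.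

(* The head of the sequence is applied first:
   [composite_reflection [:: C1; ..; Cr]] is R_{Cr} o ... o R_{C1}. *)
Definition composite_reflection (Cs : seq (set H)) x : H :=
  foldl (fun y C => reflection C y) x Cs.

Definition generalized_DR (Cs : seq (set H)) x : H :=
  2^-1 *: (x + composite_reflection Cs x).

End DouglasRachford.

(* Main.v *)
Require Import Defs.
From mathcomp Require Import all_boot all_order all_algebra.
From mathcomp Require Import sesquilinear.
From mathcomp Require Import all_classical all_reals all_analysis.
From mathcomp Require Import ring lra.

Set Implicit Arguments.
Unset Strict Implicit.
Unset Printing Implicit Defensive.

Import Order.TTheory GRing.Theory Num.Theory.
Import numFieldNormedType.Exports.

Local Open Scope classical_set_scope.
Local Open Scope ring_scope.

(* Metric projections onto closed convex sets of a Hilbert space exist and are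
   firmly nonexpansive, so each reflection is nonexpansive, and so is the
   averaged iteration map [T]; moreover [T] fixes the common points of the sets.
   If [u] is at least as close as [v] to every point of the ball of center [z]
   and radius [rho], then
     [2 rho |u - v| <= |v - z|^2 - |u - z|^2].
   For a ball inside the intersection this shows that the steps [|x_{k+1} - x_k|]
   are summable, so the sequence converges to some [p] with [T p = p]. Since
   [T] averages, with positive weights, maps that bring no point further from
   the ball, [p] is as close to each point of the ball as its image under the
   [m]-fold composite reflection. Every reflection in the composition then
   preserves these distances, so by the same inequality it fixes [p], that is,
   [p] lies in every set. *)

Lemma convex_set_segment (R : realType) (H : normedModType R) (C : set H)
    (p q : H) (t : R) :
  convex_set C -> C p -> C q -> 0 <= t -> t <= 1 -> C (p + t *: (q - p)).
Proof.
move=> Cconv Cp Cq t0 t1.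
have t01 : Itv.spec (@Itv.num_sem R) (Itv.Real `[0%Z, 1%Z]) t.
  by rewrite /= /Itv.num_sem /= num_real /= in_itv /= t0 t1.
have /set_mem := Cconv q p (Itv.mk t01) (mem_set Cq) (mem_set Cp).
suff -> : conv (Itv.mk t01) (q : convex_lmodType H) p = p + t *: (q - p) by [].
rewrite /conv /= /unstable.onem scalerBl scale1r scalerBr addrC -addrA.
by congr (_ + _); rewrite addrC.
Qed.

(** * Metric projections and reflections in an inner product space *)

Section InnerProduct.
Context (R : realType) (H : normedModType R) (dot : {dot H for idfun}).
Context (norm_dot : forall x : H, `|x| ^+ 2 = dot x x).
Implicit Types (C : set H) (x y z p q u v : H) (t rho : R).

Lemma dotC u v : dot u v = dot v u.
Proof. by rewrite hermC expr0 mul1r. Qed.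

Lemma dotZl t u v : dot (t *: u) v = t * dot u v.
Proof. exact: linearZl_LR. Qed.

Lemma dotZr t u v : dot u (t *: v) = t * dot u v.
Proof. by rewrite dotC dotZl dotC. Qed.

Lemma dotDl u v x : dot (u + v) x = dot u x + dot v x.
Proof. exact: linearDl. Qed.

Lemma dotDr u v x : dot x (u + v) = dot x u + dot x v.
Proof. by rewrite dotC dotDl !(dotC x). Qed.

Lemma dotNl u v : dot (- u) v = - dot u v.
Proof. exact: linearNl. Qed.

Lemma dotNr u v : dot u (- v) = - dot u v.
Proof. by rewrite dotC dotNl dotC. Qed.

Let dotE := (dotDl, dotDr, dotNl, dotNr, dotZl, dotZr).

Lemma sqr_normD u v : `|u + v| ^+ 2 = `|u| ^+ 2 + 2 * dot u v + `|v| ^+ 2.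
Proof. rewrite !norm_dot !dotE (dotC v u); ring. Qed.

Lemma sqr_normB u v : `|u - v| ^+ 2 = `|u| ^+ 2 - 2 * dot u v + `|v| ^+ 2.
Proof. by rewrite sqr_normD normrN dotNr mulrN. Qed.

(** Apollonius' median identity, the form of the parallelogram law that makes minimizing sequences
    Cauchy. *)
Lemma sqr_norm_midpoint x y z :
  `|x - (y + 2^-1 *: (z - y))| ^+ 2 =
  2^-1 * `|x - y| ^+ 2 + 2^-1 * `|x - z| ^+ 2 - 4^-1 * `|y - z| ^+ 2.
Proof.
rewrite !norm_dot !dotE (dotC y x) (dotC z x) (dotC z y); lra.
Qed.

(** Moving from [p] towards [y] by a fraction [t] cannot bring it closer to [x], so
    [2 t d <= t^2 N], with [d] the inner product and [N = |y - p|^2]; if [d > 0], a small [t]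
    violates this. *)
Lemma nearest_points_obtuse C x p y : convex_set C -> nearest_points C x p ->
  C y -> dot (x - p) (y - p) <= 0.
Proof.
move=> Cconv [Cp px] Cy.
set d := dot _ _; rewrite leNgt; apply/negP => d0.
have N0 : 0 <= `|y - p| ^+ 2 by rewrite exprn_ge0.
set N := `|y - p| ^+ 2 in N0 *.
have dN0 : 0 < d + N by rewrite ltr_wpDr.
(* This fraction lies in ]0, 1] even if [N = 0], and leads to [2 d (d + N) <= d N]. *)
have t0 : 0 < d / (d + N) by rewrite divr_gt0.
have t1 : d / (d + N) <= 1 by rewrite ler_pdivrMr// mul1r lerDl.
have := px _ (convex_set_segment Cconv Cp Cy (ltW t0) t1).
rewrite -ler_sqr ?nnegrE // opprD addrA (sqr_normB (x - p)) normrZ exprMn gtr0_norm //.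
rewrite dotZr -/d -/N => {}px.
have : (d / (d + N)) * (2 * d) <= (d / (d + N)) * (d / (d + N) * N).
  by move: px; set T := d / (d + N); lra.
rewrite ler_pM2l // mulrAC ler_pdivlMr // => {}px.
by have dd : 0 < d * d; [rewrite mulr_gt0 | nra].
Qed.

(** Adding the obtuse-angle inequalities at the projections [p], [q] gives
    [|p - q|^2 <= <x - y, p - q>]; then expand [|2 (p - q) - (x - y)|^2]. *)
Lemma reflection_nonexpansive C x y :
  convex_set C -> nearest_points C x !=set0 -> nearest_points C y !=set0 ->
  `|reflection C x - reflection C y| <= `|x - y|.
Proof.
move=> Cconv /(xgetPex x) nx /(xgetPex y) ny; rewrite /reflection /projection.
set p := xget _ _ in nx *; set q := xget _ _ in ny *.
have pq := nearest_points_obtuse Cconv nx ny.1.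
have qp := nearest_points_obtuse Cconv ny nx.1.
rewrite -ler_sqr ?nnegrE // !norm_dot.
rewrite -subr_ge0; move: pq qp.
rewrite !dotE.
rewrite (dotC q p) (dotC y x) (dotC y p) (dotC y q) (dotC p x) (dotC q x); lra.
Qed.

Lemma projection_id C x : C x -> projection C x = x.
Proof.
move=> Cx; have nx : nearest_points C x x.
  by split=> // y _; rewrite subrr normr0.
have [_ /(_ _ Cx)] := xgetPex x (ex_intro _ x nx).
by rewrite subrr normr0 normr_le0 subr_eq0 => /eqP.
Qed.

Lemma reflection_id C x : C x -> reflection C x = x.
Proof.
by move=> Cx; rewrite /reflection projection_id // scaler_nat mulr2n addrK.
Qed.

(** Existence of a nearest point rules out the default value of [projection], for which [x] would be
    fixed without lying in [C]. *)
Lemma fixed_reflection C x : nearest_points C x !=set0 ->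
  reflection C x = x -> C x.
Proof.
move=> /(xgetPex x)[Cp _] /(congr1 (fun y => 2^-1 *: (y + x))).
rewrite /reflection /= subrK scalerA mulVf ?pnatr_eq0 // scale1r -mulr2n.
by rewrite -(scaler_nat 2 x) scalerA mulVf ?pnatr_eq0 // scale1r => <-.
Qed.

(* The hypothesis is used at the point of the ball lying in the direction
   [v - u] from the center. *)
Lemma closer_to_ball z rho u v : 0 <= rho ->
  (forall y, `|z - y| <= rho -> `|u - y| <= `|v - y|) ->
  2 * rho * `|u - v| <= `|v - z| ^+ 2 - `|u - z| ^+ 2.
Proof.
move=> rho0 uv; have [->|neq_uv] := eqVneq u v; first by rewrite !subrr normr0 mulr0.
have n0 : 0 < `|u - v| by rewrite normr_gt0 subr_eq0.
have := uv (z - (rho / `|u - v|) *: (u - v)).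
rewrite opprB addrCA subrr addr0 normrZ normrM normfV normr_id ger0_norm //.
rewrite divfK ?gt_eqF // => /(_ (lexx _)).
rewrite -ler_sqr ?nnegrE // !(addrCA _ (_ *: _)).
rewrite !(sqr_normD (_ *: _)) !dotZl => uv'.
(* The term [|s (u - v)|^2] occurs on both sides of [uv'] and cancels. *)
have : 2 * (rho / `|u - v|) * dot (u - v) (u - v) <= `|v - z| ^+ 2 - `|u - z| ^+ 2.
  move: uv'; set s := rho / _.
  have -> : dot (u - v) (u - v) = dot (u - v) (u - z) - dot (u - v) (v - z).
    rewrite !dotE; ring.
  lra.
by rewrite -norm_dot expr2 !mulrA mulfVK ?gt_eqF.
Qed.

End InnerProduct.

(** A minimizing sequence for the squared distance is Cauchy; its limit stays in [C] and attains the
    infimum. *)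
Lemma closed_convex_nearest_point (R : realType) (H : completeNormedModType R)
    (dot : {dot H for idfun}) (norm_dot : forall x : H, `|x| ^+ 2 = dot x x)
    (C : set H) (x : H) :
  C !=set0 -> closed C -> convex_set C -> nearest_points C x !=set0.
Proof.
move=> [c Cc] Cclosed Cconv.
pose S := [set `|x - y| ^+ 2 | y in C].
have lbS : has_lbound S by exists 0 => _ [y _ <-]; rewrite exprn_ge0.
have infS : has_inf S by split=> //; exists (`|x - c| ^+ 2), c.
have inf_le y : C y -> inf S <= `|x - y| ^+ 2.
  by move=> Cy; apply: ge_inf => //; exists y.
have /choice[y y_min] (n : nat) :
    exists y, C y /\ `|x - y| ^+ 2 < inf S + harmonic n.
  have [_ [y Cy <-] lty] := inf_adherent (harmonic_gt0 n) infS.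
  by exists y.
have half01 : 0 <= 2^-1 :> R /\ 2^-1 <= 1 :> R by split; lra.
(* The midpoint of [y n] and [y k] lies in [C], so its squared distance to [x] is at least
   [inf S]. *)
have y_cauchy n k : `|y n - y k| ^+ 2 <= 2 * (harmonic n + harmonic k).
  have [Cn ltn] := y_min n; have [Ck ltk] := y_min k.
  have := inf_le _ (convex_set_segment Cconv Cn Ck half01.1 half01.2).
  by rewrite (sqr_norm_midpoint norm_dot); lra.
have : cvg (y @ \oo).
  apply/cauchy_cvgP/cauchy_exP => e e0.
  have e40 : 0 < e ^+ 2 / 4 by rewrite divr_gt0 ?exprn_gt0.
  have /cvgrPdist_lt/(_ _ e40)[N _ ltN] := @cvg_harmonic R.
  have {}ltN n : (N <= n)%N -> harmonic n < e ^+ 2 / 4.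
    by move=> /ltN /=; rewrite sub0r normrN ger0_norm // invr_ge0.
  exists (y N), N => // n /= leNn; rewrite -ball_normE /ball_ /=.
  rewrite -ltr_sqr ?nnegrE ?(ltW e0) // (le_lt_trans (y_cauchy _ _)) //.
  have := ltN _ (leqnn N); have := ltN _ leNn; lra.
move=> /cvg_ex[p yp]; exists p; split.
  by apply: (@closed_cvg _ _ \oo _ y C Cclosed _ p yp); apply: nearW => n; have [] := y_min n.
have le_inf : `|x - p| ^+ 2 <= inf S.
  rewrite -[leRHS]addr0; apply: (@ler_cvg_to _ \oo).
  - rewrite expr2; apply: cvgM; apply: cvg_norm; apply: cvgB yp; exact: cvg_cst.
  - apply: cvgD cvg_harmonic; exact: cvg_cst.
  - by apply: nearW => n /=; rewrite -expr2 ltW//; have [] := y_min n.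
by move=> z Cz; rewrite -ler_sqr ?nnegrE // (le_trans le_inf) ?inf_le.
Qed.

(** * Compositions of reflections and Fejér monotone sequences *)

Section CompositeReflection.
Context (R : realType) (H : completeNormedModType R) (dot : {dot H for idfun}).
Context (norm_dot : forall x : H, `|x| ^+ 2 = dot x x).

Let closed_convex (C : set H) := [/\ C !=set0, closed C & convex_set C].

Let reflection_lip (C : set H) : closed_convex C ->
  forall u v, `|reflection C u - reflection C v| <= `|u - v|.
Proof.
move=> [C0 Ccl Ccv] u v; apply: (reflection_nonexpansive norm_dot) => //;
  exact: (closed_convex_nearest_point norm_dot).
Qed.

Lemma composite_reflection_nonexpansive (s : seq (set H)) (u v : H) :
  (forall C, C \in s -> closed_convex C) ->
  `|composite_reflection s u - composite_reflection s v| <= `|u - v|.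
Proof.
elim: s u v => [//|C s IH] u v sP /=.
have sP' D : D \in s -> closed_convex D by move=> Ds; apply: sP; rewrite inE Ds orbT.
by apply: le_trans (IH _ _ sP') (reflection_lip (sP _ (mem_head _ _)) _ _).
Qed.

Lemma composite_reflection_id (s : seq (set H)) (y : H) :
  (forall C, C \in s -> C y) -> composite_reflection s y = y.
Proof.
elim: s => [//|C s IH] sy /=; rewrite reflection_id; last by apply: sy; rewrite mem_head.
by apply: IH => D Ds; apply: sy; rewrite inE Ds orbT.
Qed.

Lemma composite_reflection_fejer (s : seq (set H)) (x y : H) :
  (forall C, C \in s -> closed_convex C) -> (forall C, C \in s -> C y) ->
  `|composite_reflection s x - y| <= `|x - y|.
Proof.
move=> sP sy; rewrite -{1}(composite_reflection_id sy).
exact: composite_reflection_nonexpansive.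
Qed.

Lemma generalized_DR_nonexpansive (s : seq (set H)) (u v : H) :
  (forall C, C \in s -> closed_convex C) ->
  `|generalized_DR s u - generalized_DR s v| <= `|u - v|.
Proof.
move=> sP; rewrite /generalized_DR -scalerBr normrZ gtr0_norm ?invr_gt0 //.
rewrite opprD addrACA ler_pdivrMl // mulr_natl mulr2n.
apply: le_trans (ler_normD _ _) _.
by rewrite lerD2l composite_reflection_nonexpansive.
Qed.

Lemma generalized_DR_id (s : seq (set H)) (y : H) :
  (forall C, C \in s -> C y) -> generalized_DR s y = y.
Proof.
move=> sy; rewrite /generalized_DR composite_reflection_id //.
by rewrite -mulr2n -(scaler_nat 2 y) scalerA mulVf ?pnatr_eq0 // scale1r.
Qed.

(* Each reflection brings [x] at least as close to every point of the ball;
   if the composition brings it no closer, then neither does the first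
   reflection, which must therefore fix [x]. *)
Lemma composite_reflection_equidistant (s : seq (set H)) (x z : H) (rho : R) :
  0 < rho -> (forall C, C \in s -> closed_convex C) ->
  (forall C y, C \in s -> `|z - y| <= rho -> C y) ->
  (forall y, `|z - y| <= rho -> `|x - y| <= `|composite_reflection s x - y|) ->
  forall C, C \in s -> C x.
Proof.
move=> rho0; elim: s => [//|C s IH] sP sball xeq.
have sP' D : D \in s -> closed_convex D by move=> Ds; apply: sP; rewrite inE Ds orbT.
have sball' D y : D \in s -> `|z - y| <= rho -> D y.
  by move=> Ds; apply: sball; rewrite inE Ds orbT.
have CP := sP _ (mem_head _ _).
have Cfejer y : `|z - y| <= rho -> `|reflection C x - y| <= `|x - y|.
  move=> zy; have Cy : C y by apply: sball zy; rewrite mem_head.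
  by rewrite -{1}(reflection_id Cy); apply: reflection_lip.
have xR y : `|z - y| <= rho -> `|x - y| <= `|reflection C x - y|.
  move=> zy; apply: le_trans (xeq _ zy) _.
  by apply: (@composite_reflection_fejer s (reflection C x) y) => // D /sball'; apply.
have RCx : reflection C x = x.
  apply/eqP; rewrite -subr_eq0 -normr_le0.
  have zz : `|z - z| <= rho by rewrite subrr normr0 ltW.
  have := closer_to_ball norm_dot (ltW rho0) Cfejer.
  have -> : `|reflection C x - z| = `|x - z|.
    by apply/eqP; rewrite eq_le xR ?Cfejer.
  by rewrite subrr pmulr_rle0 // mulr_gt0.
have Cx : C x.
  by case: CP => *; apply: fixed_reflection RCx;
    exact: (closed_convex_nearest_point norm_dot).
move=> D; rewrite inE => /predU1P[-> //|]; apply: IH => // y zy.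
by move: (xeq y zy); rewrite /composite_reflection /= RCx.
Qed.

(** By [closer_to_ball], each step is at most an increment of the nondecreasing sequence [b], which
    is bounded above by 0; so the series of steps converges absolutely. *)
Lemma fejer_ball_cvg (x : nat -> H) (z : H) (rho : R) : 0 < rho ->
  (forall k y, `|z - y| <= rho -> `|x k.+1 - y| <= `|x k - y|) -> cvgn x.
Proof.
move=> rho0 fejer; pose b n := - (`|x n - z| ^+ 2 / (2 * rho)).
have rho20 : 0 < 2 * rho by rewrite mulr_gt0.
have step n : `|telescope x n| <= telescope b n.
  rewrite /telescope /b /= opprK [leRHS]addrC -mulrBl ler_pdivlMr // mulrC.
  exact: closer_to_ball norm_dot _ _ _ _ (ltW rho0) (fejer n).
have b_cvg : cvgn b.
  apply: nondecreasing_is_cvgn.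
    apply/nondecreasing_seqP => n; rewrite -subr_ge0.
    exact: le_trans (normr_ge0 _) (step n).
  exists 0 => _ [n _ <-]; rewrite oppr_le0 divr_ge0 ?exprn_ge0 //.
  exact: ltW.
have : cvgn (series (telescope x)).
  apply: normed_cvg; apply: (series_le_cvg _ _ step) => [n|n|] //.
    exact: le_trans (normr_ge0 _) (step n).
  by rewrite telescopeK; apply: is_cvgB => //; apply: is_cvg_cst.
move=> sx; have -> : x = (fun n => x 0%N + series (telescope x) n).
  by apply/funext => n; rewrite -eq_sum_telescope.
by apply: is_cvgD => //; apply: is_cvg_cst.
Qed.

End CompositeReflection.

Theorem theorem24 (R : realType) (H : completeNormedModType R)
    (dot : {dot H for idfun})
    (norm_dot : forall x : H, `|x| ^+ 2 = dot x x)
    (m : nat) (m_ge2 : (2 <= m)%N)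
    (C : nat -> set H)
    (C_nonempty : forall i : nat, (1 <= i <= m)%N -> C i !=set0)
    (C_closed : forall i : nat, (1 <= i <= m)%N -> closed (C i))
    (C_convex : forall i : nat, (1 <= i <= m)%N -> convex_set (C i))
    (C_meet : \bigcap_(i in [set i : nat | (1 <= i <= m)%N]) C i !=set0)
    (w : nat -> R)
    (w_gt0 : forall r : nat, (2 <= r <= m)%N -> 0 < w r)
    (w_sum1 : \sum_(2 <= r < m.+1) w r = 1)
    (C_int : (\bigcap_(i in [set i : nat | (1 <= i <= m)%N]) C i)° !=set0)
    (x : nat -> H)
    (x_rec : forall k : nat, x k.+1 = \sum_(2 <= r < m.+1)
       w r *: generalized_DR [seq C i | i <- index_iota 1 r.+1] (x k)) :
  exists2 xstar : H,
    (\bigcap_(i in [set i : nat | (1 <= i <= m)%N]) C i) xstar &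
    x @ \oo --> xstar.
Proof.
pose s r := [seq C i | i <- index_iota 1 r.+1].
pose T u := \sum_(2 <= r < m.+1) w r *: generalized_DR (s r) u.
have s_in r D : (r <= m)%N -> D \in s r -> exists2 i, (1 <= i <= m)%N & D = C i.
  move=> rm /mapP[i]; rewrite mem_index_iota ltnS => /andP[i1 ir] ->.
  by exists i; rewrite // i1 (leq_trans ir).
have s_closed_convex r : (r <= m)%N ->
    forall D, D \in s r -> [/\ D !=set0, closed D & convex_set D].
  by move=> rm D /(s_in _ _ rm)[i im ->]; split;
    [exact: C_nonempty|exact: C_closed|exact: C_convex].
have T_nonexpansive u v : `|T u - T v| <= `|u - v|.
  rewrite /T -sumrB -[leRHS]mul1r -w_sum1 mulr_suml.
  rewrite !big_nat; apply: le_trans (ler_norm_sum _ _ _) _.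
  apply: ler_sum => r /andP[r2 rm].
  have wr : 0 < w r by rewrite w_gt0 // r2.
  rewrite -scalerBr normrZ gtr0_norm // ler_pM2l //.
  exact: generalized_DR_nonexpansive norm_dot _ _ _ (s_closed_convex r rm).
have [z zint] := C_int.
have [rho rho0 ball_int] : exists2 rho, 0 < rho &
    forall y, `|z - y| <= rho -> forall i, (1 <= i <= m)%N -> C i y.
  move: zint; rewrite /interior /= nbhs_ballP => -[e /= e0 ze].
  (* Halving the radius of the open ball leaves room for a closed one. *)
  exists (e / 2); rewrite ?divr_gt0 // => y zy; apply: ze.
  by rewrite -ball_normE /ball_ /= (le_lt_trans zy) // gtr_pMr // invf_lt1 // ltr1n.
have s_ball r D y : (r <= m)%N -> D \in s r -> `|z - y| <= rho -> D y.
  by move=> rm /(s_in _ _ rm)[i im ->] zy; apply: ball_int.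
have T_id y : `|z - y| <= rho -> T y = y.
  move=> zy; rewrite /T -[RHS]scale1r -w_sum1 scaler_suml !big_nat.
  apply: eq_bigr => r /andP[r2 rm]; rewrite generalized_DR_id // => D Dr.
  exact: s_ball rm Dr zy.
have x_cvg : cvgn x.
  apply: (fejer_ball_cvg norm_dot rho0) => k y zy.
  by rewrite x_rec -/(T _) -{1}(T_id y zy).
move: x_cvg => /cvg_ex[p xp]; exists p => //.
(* The shifted sequence tends to [T p] by nonexpansiveness, and to [p]. *)
have Tp : T p = p.
  apply: (@cvg_unique _ (@norm_hausdorff _ H) (x n.+1 @[n --> \oo])).
    apply/cvgrPdist_le => e e0; near=> n.
    rewrite x_rec -/(T _) (le_trans (T_nonexpansive _ _)) //.
    near: n; exact: cvgr_dist_le.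
  by have := xp; rewrite -cvg_shiftS.
(* The longest composition, [r = m], involves every set. *)
suff Cp : forall D, D \in s m -> D p.
  by move=> i /= im; apply: Cp; apply: map_f; rewrite mem_index_iota ltnS.
apply: (composite_reflection_equidistant norm_dot rho0) => // [|D y Dm|y zy].
- exact: s_closed_convex.
- exact: s_ball Dm.
- have wm : 0 < w m by rewrite w_gt0 // m_ge2 leqnn.
  have Ty := T_id y zy.
  (* Only the term [r = m] is kept apart; the others are bounded by nonexpansiveness. *)
  have : `|T p - T y| <=
      (\sum_(2 <= r < m) w r) * `|p - y| + w m * `|generalized_DR (s m) p - y|.
    rewrite /T -sumrB big_nat_recr //= -scalerBr.
    apply: le_trans (ler_normD _ _) _; apply: lerD.
      rewrite mulr_suml !big_nat; apply: le_trans (ler_norm_sum _ _ _) _.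
      apply: ler_sum => r /andP[r2 rm].
      have wr : 0 < w r by rewrite w_gt0 // r2 ltnW.
      rewrite -scalerBr normrZ gtr0_norm // ler_pM2l //.
      exact: generalized_DR_nonexpansive norm_dot _ _ _ (s_closed_convex r (ltnW rm)).
    have -> : generalized_DR (s m) y = y.
      by apply: generalized_DR_id => D Dm; exact: s_ball (leqnn m) Dm zy.
    by rewrite normrZ gtr0_norm.
  have : `|generalized_DR (s m) p - y| <=
      2^-1 * (`|p - y| + `|composite_reflection (s m) p - y|).
    have -> : generalized_DR (s m) p - y =
        2^-1 *: ((p - y) + (composite_reflection (s m) p - y)).
      rewrite addrACA -opprD scalerBr -mulr2n -(scaler_nat 2 y) scalerA.
      by rewrite mulVf ?pnatr_eq0 // scale1r.
    by rewrite normrZ gtr0_norm ?invr_gt0 // ler_pM2l ?invr_gt0 // ler_normD.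
  (* With [a = |p - y|] and [c] the distance from the image of [p] to [y], the bounds give
     [a <= (1 - w m) a + w m (a + c) / 2], hence [a <= c] as [w m > 0]. *)
  rewrite Tp Ty; move: w_sum1; rewrite big_nat_recr //=.
  set W := \sum_(2 <= r < m) _ => wW; have -> : W = 1 - w m by lra.
  by nra.
Unshelve. all: by end_near.
Qed.
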